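(* Let $q\in\mathbb{R}$ and let $c\in\mathbb{R}$ satisfy $1+(1-q)c>0$. Then the shift $x\mapsto x+c$ applied to $y=\exp_q(x)$ is equivalent to a rescaling in both the $x$-axis and the $y$-axis, namely $$y':=\frac{y}{\exp_q(c)},\qquad x':=\frac{x}{(\exp_q(c))^{1-q}}.$$ That is, for all $x,y\in\mathbb{R}$, one has $1+(1-q)(x+c)>0$ if and only if $1+(1-q)x'>0$, and when this holds, $$y=\exp_q(x+c)\quad\Longleftrightarrow\quad y'=\exp_q(x').$$
   Context: For $q\neq 1$, the $q$-exponential function is $\exp_q(x):=[1+(1-q)x]^{\frac{1}{1-q}}$, defined for real $x$ with $1+(1-q)x>0$. For $q=1$, $\exp_1(x):=e^x$ for all $x\in\mathbb{R}$. *)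

(* Defs.v *)
From mathcomp Require Import all_boot all_order all_algebra.
From mathcomp Require Import all_classical all_reals all_analysis.

Set Implicit Arguments.
Unset Strict Implicit.
Unset Printing Implicit Defensive.

Import Order.TTheory GRing.Theory Num.Theory.
Local Open Scope ring_scope.

(* The q-exponential is a partial function, with domain
   0 < 1 + (1 - q) * x (all of R when q = 1).  The total function below is
   meaningful only there; elsewhere its value is an artefact of powR. *)
Definition expq (R : realType) (q x : R) : R :=
  if q == 1 then expR x else (1 + (1 - q) * x) `^ (1 / (1 - q)).

(* Main.v *)
(* Writing A = 1 + (1 - q) c, one has exp_q(c)^(1-q) = A, so that
   1 + (1 - q)(x + c) = A (1 + (1 - q) x / A), and raising to the power
   1/(1-q) gives exp_q(x + c) = exp_q(c) exp_q(x / A). *)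
Require Import Defs.
From mathcomp Require Import all_boot all_order all_algebra.
From mathcomp Require Import all_classical all_reals all_analysis.
From mathcomp Require Import ring.

Set Implicit Arguments.
Unset Strict Implicit.
Unset Printing Implicit Defensive.

Import Order.TTheory GRing.Theory Num.Theory.
Local Open Scope ring_scope.

(** With A = 1 + (1 - q) c > 0, the base at x + c is A times the base at x / A ([expq_arg_factor]),
    so the two domains agree. Taking powers yields the product rule [expqD]. By [expq_powR], x / A
    is exactly x', and dividing by exp_q(c) > 0 is reversible. *)

Lemma expq_gt0 (R : realType) (q c : R) :
  0 < 1 + (1 - q) * c -> 0 < expq q c.
Proof.
by move=> hc; rewrite /expq; case: ifP => _; [exact: expR_gt0 | exact: powR_gt0].
Qed.

(** The exponents 1/(1 - q) and 1 - q cancel; for q = 1 the exponent 0 makes both sides 1. *)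
Lemma expq_powR (R : realType) (q c : R) :
  0 < 1 + (1 - q) * c -> expq q c `^ (1 - q) = 1 + (1 - q) * c.
Proof.
move=> hc; rewrite /expq; case: eqVneq => [->|q1].
  by rewrite subrr powRr0 mul0r addr0.
rewrite -powRrM divfK ?powRr1 ?ltW //.
by rewrite subr_eq0 eq_sym.
Qed.

Lemma expq_arg_factor (R : realType) (q c x : R) : 0 < 1 + (1 - q) * c ->
  1 + (1 - q) * (x + c) =
  (1 + (1 - q) * c) * (1 + (1 - q) * (x / (1 + (1 - q) * c))).
Proof. by move=> /lt0r_neq0 hc; field. Qed.

Lemma expqD (R : realType) (q c x : R) :
  0 < 1 + (1 - q) * c -> 0 < 1 + (1 - q) * (x + c) ->
  expq q (x + c) = expq q c * expq q (x / (1 + (1 - q) * c)).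
Proof.
(* Factoring turns the hypothesis at x + c into positivity of the second factor, so that [powRM] can
   split the power. *)
move=> hc; rewrite {1}expq_arg_factor // pmulr_rgt0 // => hx.
rewrite /expq; case: eqVneq => [->|q1].
  by rewrite subrr mul0r addr0 divr1 addrC expRD.
by rewrite expq_arg_factor // powRM ?ltW.
Qed.

Theorem proposition2 (R : realType) (q c : R) (hc : 0 < 1 + (1 - q) * c)
    (x y : R) :
  let y' := y / expq q c in
  let x' := x / (expq q c `^ (1 - q)) in
  (0 < 1 + (1 - q) * (x + c) <-> 0 < 1 + (1 - q) * x') /\
  (0 < 1 + (1 - q) * (x + c) ->
     (y = expq q (x + c) <-> y' = expq q x')).
Proof.
move=> y' x'; rewrite {}/x' {}/y' expq_powR //; split.
  by rewrite expq_arg_factor // pmulr_rgt0.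
have e0 : expq q c != 0 by rewrite lt0r_neq0 ?expq_gt0.
move=> hx; rewrite expqD //; split=> [->|<-].
  by rewrite mulrC mulKf.
by rewrite mulrC divfK.
Qed.
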